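(* Consider $N\ge 2$ agents $\theta_1,\dots,\theta_N\in S^1$ interconnected according to a connected, fixed (time-independent), undirected, unweighted graph $\mathbb{G}$ on the vertex set $\{1,\dots,N\}$. Let $a>0$ and let $g:S^1\to\mathbb{R}$ be (a smoothed version of) the $2\pi$-periodic function defined by $$g(\theta)=\begin{cases}-\frac{a}{N-1}(\pi+\theta) & \theta\in[-\pi,-\frac{\pi}{N}],\\ a\,\theta & \theta\in[-\frac{\pi}{N},\frac{\pi}{N}],\\ \frac{a}{N-1}(\pi-\theta) & \theta\in[\frac{\pi}{N},\pi],\end{cases}$$ where smoothing means that the corners of this piecewise linear function are rounded off so that $g$ is continuously differentiable everywhere. Suppose the agents evolve according to $$\tfrac{d}{dt}\theta_k=\sum_{j\sim k} g(\theta_j-\theta_k),\qquad k=1,\dots,N,$$ where $j\sim k$ means that $j$ and $k$ are neighbors in $\mathbb{G}$. Then the agents always (i.e. for every initial condition) converge to the set of equilibria corresponding to the critical points of $$V_g(\theta)=\tfrac12\sum_{k=1}^N\sum_{j\sim k} \bigl(z(\theta_j-\theta_k)\bigr)^2,$$ where $(z(\cdot))^2$ is the even, $2\pi$-periodic function whose derivative is $g$ and which vanishes at $0$. Moreover, the only asymptotically stable equilibrium is synchronization, $\theta_1=\theta_2=\dots=\theta_N$.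
   Context: $S^1=\mathbb{R}/2\pi\mathbb{Z}$. For the unsmoothed $g$, explicitly, $(z(\theta))^2=\frac a2\theta^2$ for $|\theta|\le\frac{\pi}{N}$ and $(z(\theta))^2=-\frac{a\pi^2}{2N(N-1)}+\frac{a}{N-1}\bigl(\pi|\theta|-\frac{\theta^2}{2}\bigr)$ for $\frac{\pi}{N}\le|\theta|\le\pi$, extended $2\pi$-periodically; for the smoothed $g$ it is modified accordingly. The corners of the unsmoothed $g$ are at $\theta=\pm\frac{\pi}{N}$ (modulo $2\pi$); the smoothed $g$ is still odd and $2\pi$-periodic. A critical point of a differentiable function is a point where its gradient is zero. The dynamics are invariant under uniform rotation $\theta_k\mapsto\theta_k+c$ for all $k$; a configuration is a point of $(S^1)^N$ together with all the points obtained from it by uniform rotations, and the behavior of the agents is described in terms of configurations (relative positions), so that asymptotic stability of an equilibrium is understood modulo uniform rotation of all agents, and synchronization is a single configuration. *)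

(* Defs.v *)
From HB Require Import structures.
From mathcomp Require Import all_boot all_order all_algebra.
From mathcomp Require Import all_classical all_reals all_analysis.
Import Order.TTheory GRing.Theory Num.Theory.
Import numFieldNormedType.Exports.
Set Implicit Arguments.
Unset Strict Implicit.
Unset Printing Implicit Defensive.
Local Open Scope classical_set_scope.
Local Open Scope ring_scope.

(* The circle S^1 = R / 2 pi Z is handled through lifts: a
   point of S^1 is represented by a real number, a function on S^1 by a
   2 pi-periodic function on R, a point of (S^1)^N by a row vector in R^N and a
   curve in (S^1)^N by a continuous lift.  A subset of (S^1)^N is represented by
   its full preimage in R^N; for such subsets the distance on the torus to the
   subset is the distance in R^N (sup norm) to the preimage. *)

Section coupling_function.
Context {R : realType}.
Implicit Types (N : nat) (a d : R) (g q : R -> R).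

(* The formula is meant for t in [-pi, pi] only. *)
Definition tent N a (t : R) : R :=
  if t <= - (pi / N%:R) then - (a / (N%:R - 1)) * (pi + t)
  else if t <= pi / N%:R then a * t
  else a / (N%:R - 1) * (pi - t).

Definition unsmoothed N a g : Prop :=
  periodic g (pi *+ 2) /\ forall t, - pi <= t <= pi -> g t = tent N a t.

(* The corners +-pi/N are rounded off inside the open d-neighbourhoods of these
   points; the slope stays between the slopes of the two adjacent segments. *)
Record rounded N a d g : Prop := Rounded {
  rounded_odd : forall t, g (- t) = - g t;
  rounded_periodic : periodic g (pi *+ 2);
  rounded_derivable : forall t : R, derivable g t 1;
  rounded_C1 : continuous (derive1 g);
  rounded_tent : forall t, - pi <= t <= pi -> d <= `| `|t| - pi / N%:R | ->
    g t = tent N a t;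
  rounded_slope : forall t, - (a / (N%:R - 1)) <= derive1 g t <= a }.

(* The bound on d makes "rounding off" a local modification of the corners: it
   gives pi/N + d < pi/(N-1) and keeps g positive on ]0, pi[.  With arbitrarily
   large d, g could lose the shape of the tent altogether. *)
Definition smoothed N a g : Prop :=
  exists2 d : R, 0 < d < pi / (2 * N%:R * (N%:R - 1)) & rounded N a d g.

(* q is the function written (z(.))^2, which g determines uniquely. *)
Record squared_distance g q : Prop := SquaredDistance {
  sqd_even : forall t, q (- t) = q t;
  sqd_periodic : periodic q (pi *+ 2);
  sqd_derive : forall t : R, is_derive t 1 q (g t);
  sqd_0 : q 0 = 0 }.

End coupling_function.

Section agents.
Context {R : realType} {N : nat}.
Implicit Types (e : rel 'I_N) (g q : R -> R) (theta : 'rV[R]_N)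
  (x : R -> 'rV[R]_N) (A : set 'rV[R]_N) (V : 'rV[R]_N -> R).

Definition connected_graph e : Prop :=
  [/\ symmetric e, irreflexive e & forall i j, connect e i j].

Definition velocity e g theta : 'rV[R]_N :=
  \row_k \sum_(j | e k j) g (theta 0 j - theta 0 k).

(* Values of x at negative times are irrelevant. *)
Definition solution e g x : Prop :=
  {within `[0, +oo[, continuous x} /\
  forall t : R, 0 < t -> is_derive t 1 x (velocity e g (x t)).

Definition equilibria e g : set 'rV[R]_N := [set theta | velocity e g theta = 0].

Definition potential e q theta : R :=
  2^-1 * \sum_k \sum_(j | e k j) q (theta 0 j - theta 0 k).

Definition gradient V theta : 'rV[R]_N := \row_k 'D_(delta_mx 0 k) V theta.

Definition critical_points V : set 'rV[R]_N :=
  [set theta | differentiable V theta /\ gradient V theta = 0].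

Definition neighborhood A (eps : R) : set 'rV[R]_N := \bigcup_(y in A) ball y eps.

Definition converges_to x A : Prop :=
  forall eps : R, 0 < eps -> \forall t \near +oo, neighborhood A eps (x t).

(* All lifts of the points of (S^1)^N obtained from theta by uniform rotations. *)
Definition configuration theta : set 'rV[R]_N :=
  [set y | exists (c : R) (m : 'I_N -> int),
     forall k, y 0 k = theta 0 k + c + 2 * pi * (m k)%:~R].

Definition asymptotically_stable e g theta : Prop :=
  [/\ equilibria e g theta,
      forall eps : R, 0 < eps -> exists2 d : R, 0 < d &
        forall x, solution e g x ->
          neighborhood (configuration theta) d (x 0) ->
          forall t, 0 <= t -> neighborhood (configuration theta) eps (x t)
    & exists2 d : R, 0 < d &
        forall x, solution e g x ->
          neighborhood (configuration theta) d (x 0) ->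
          converges_to x (configuration theta)].

(* theta_1 = ... = theta_N as points of S^1. *)
Definition synchronized theta : Prop :=
  forall i j, exists m : int, theta 0 i - theta 0 j = 2 * pi * m%:~R.

End agents.

(* Main.v *)
(* The system is the gradient flow of the potential V.  Along a solution V
   decreases at the rate |grad V|^2, which is Lipschitz in time, so it tends to
   0; compactness of the torus then gives convergence to the critical points.
   V is nonnegative and vanishes exactly on the synchronized states, hence is a
   Lyapunov function there.  For any other equilibrium, link two agents when
   their distance on the circle is at most rho, the end of the increasing part
   of g.  If the links connected all agents, a chain of them would fit in less
   than a half circle and the foremost agent would be pulled back strictly.  So
   some set of agents is far from its complement; every edge across this cut
   lies where g has slope -b < 0, so rotating that set lowers V at second order.
   The solution issued from such a perturbation, given by Picard iteration,
   cannot return. *)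

Require Import Defs.
From mathcomp Require Import all_boot all_order all_algebra.
From mathcomp Require Import all_classical all_reals all_analysis.
From mathcomp Require Import ring lra.
Import Order.TTheory GRing.Theory Num.Theory.
Import numFieldNormedType.Exports.
Set Implicit Arguments.
Unset Strict Implicit.
Unset Printing Implicit Defensive.
Local Open Scope classical_set_scope.
Local Open Scope ring_scope.

(** * Consequences of the mean value theorem *)

Section calculus.
Context {R : realType}.
Implicit Types (f df F dF : R -> R) (s t x : R).

Lemma derive_continuous f x (l : R) : is_derive x 1 f l -> {for x, continuous f}.
Proof.
by move=> [fx _]; apply/differentiable_continuous/derivable1_diffP.
Qed.

Lemma derive_within_continuous f df s t :
  (forall x, is_derive x 1 f (df x)) -> {within `[s, t], continuous f}.
Proof.
by move=> fx; apply: continuous_subspaceT => x; exact: derive_continuous.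
Qed.

(** The mean value theorem applied to [F - f]. Derivatives are asked for only inside the interval,
    because a solution need not be differentiable at time 0. *)
Lemma increment_le f df F dF s t : s <= t ->
  (forall x, s < x < t -> is_derive x 1 f (df x)) ->
  (forall x, s < x < t -> is_derive x 1 F (dF x)) ->
  {within `[s, t], continuous f} -> {within `[s, t], continuous F} ->
  (forall x, s < x < t -> df x <= dF x) -> f t - f s <= F t - F s.
Proof.
move=> st Df DF cf cF le.
have [<-|ne] := eqVneq s t; first by rewrite !subrr.
have [|||x xst E] := @MVT R (F - f) (dF - df) s t.
- by rewrite lt_neqAle ne.
- move=> x xst; move: (xst); rewrite in_itv /= => xst'.
  have := Df x xst'; have := DF x xst' => ? ?; exact: is_deriveB.
- exact: within_continuousB.
have : 0 <= (dF x - df x) * (t - s).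
  by apply: mulr_ge0; rewrite subr_ge0// le//; move: xst; rewrite in_itv.
by move: E; rewrite /= !fctE => <-; lra.
Qed.

Lemma increment_norm_le f df F dF s t : s <= t ->
  (forall x, s < x < t -> is_derive x 1 f (df x)) ->
  (forall x, s < x < t -> is_derive x 1 F (dF x)) ->
  {within `[s, t], continuous f} -> {within `[s, t], continuous F} ->
  (forall x, s < x < t -> `|df x| <= dF x) -> `|f t - f s| <= F t - F s.
Proof.
move=> st Df DF cf cF le; rewrite ler_norml; apply/andP; split; last first.
  by apply: (increment_le st Df DF) => // x /le; rewrite ler_norml => /andP[].
have : (- f) t - (- f) s <= F t - F s; last by rewrite !fctE; lra.
apply: (@increment_le _ (- df) _ dF) => //.
- by move=> x /Df ?; exact: is_deriveN.
- by move=> x; apply: continuousN; exact: cf.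
- by move=> x /le; rewrite ler_norml !fctE => /andP[]; lra.
Qed.

Lemma is_derive_linear (c x : R) : is_derive x 1 ( *%R c) c.
Proof.
have -> : *%R c = c *: id by apply/funext => y; rewrite !fctE.
by apply: is_derive_eq; rewrite /GRing.scale /= mulr1.
Qed.

Lemma derive_le0_le f df s t : s <= t ->
  (forall x, is_derive x 1 f (df x)) -> (forall x, s < x < t -> df x <= 0) ->
  f t <= f s.
Proof.
move=> st Df df0; rewrite -subr_le0.
suff : f t - f s <= cst 0 t - cst 0 s by rewrite /cst subrr.
apply: (@increment_le _ df _ (cst 0)) => //.
  exact: derive_within_continuous.
by apply: continuous_subspaceT => x; exact: cst_continuous.
Qed.

Lemma derive_eq0_const f df s t : s <= t ->
  (forall x, is_derive x 1 f (df x)) -> (forall x, s < x < t -> df x = 0) ->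
  f s = f t.
Proof.
move=> st Df df0; apply/eqP; rewrite eq_sym -subr_eq0 -normr_le0.
suff : `|f t - f s| <= cst 0 t - cst 0 s by rewrite /cst subrr.
apply: (@increment_norm_le _ df _ (cst 0)) => //.
- exact: derive_within_continuous.
- by apply: continuous_subspaceT => x; exact: cst_continuous.
- by move=> x /df0 ->; rewrite normr0.
Qed.

Lemma derive_bound_lipschitz f df c s t :
  (forall x, is_derive x 1 f (df x)) -> (forall x, `|df x| <= c) ->
  `|f s - f t| <= c * `|s - t|.
Proof.
move=> Df le; wlog st : s t / t <= s.
  move=> H; case: (leP t s) => [|/ltW] /H //.
  by rewrite distrC (distrC s).
rewrite (@ger0_norm _ (s - t)) ?subr_ge0// mulrBr.
apply: (@increment_norm_le _ df _ (fun=> c)) => //.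
- by move=> x _; exact: is_derive_linear.
- exact: derive_within_continuous.
- by apply: (@derive_within_continuous _ (fun=> c)) => x; exact: is_derive_linear.
Qed.

End calculus.

(** * Reduction of periodic functions to one period *)

Section periodicity.
Context {R : realType}.
Implicit Types (f g : R -> R) (s t : R).

Lemma periodicz f t (m : int) :
  periodic f (pi *+ 2) -> f (t + 2 * pi * m%:~R) = f t.
Proof.
move=> pf; have E n : 2 * pi * n%:R = pi *+ 2 *+ n :> R.
  by rewrite mulr_natr mulr_natl.
case: m => n; first by rewrite -pmulrn E periodicn.
rewrite NegzE mulrNz mulrN -(periodicn pf n.+1 (t - _)).
by rewrite -pmulrn E addrNK.
Qed.

Lemma mod_2pi t : exists m : int, - pi <= t + 2 * pi * m%:~R <= pi.
Proof.
have pi0 : 0 < pi :> R := pi_gt0 R.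
exists (- Num.floor ((t + pi) / (2 * pi))).
have /andP[] := real_floor_itv (num_real ((t + pi) / (2 * pi))).
rewrite ler_pdivlMr ?ltr_pdivrMr ?mulr_gt0// intrD mulr1z mulrNz.
by move=> ? ?; apply/andP; split; lra.
Qed.

Lemma periodic_odd f : periodic f (pi *+ 2) ->
  (forall t, - pi <= t <= pi -> f (- t) = - f t) -> forall t, f (- t) = - f t.
Proof.
move=> pf oddf t; have [m mt] := mod_2pi t.
rewrite -(@periodicz f t m)// -oddf// -(@periodicz f (- (_ + _)) m)//; congr f; lra.
Qed.

(** Translations bring [s] into [[-pi, pi]] and [t] within one turn after [s]. If [t] is then beyond
    [pi], the path is cut at [pi], where [f pi = f (- pi)]. *)
Lemma periodic_lipschitz f c : periodic f (pi *+ 2) ->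
  (forall s t, - pi <= s -> s <= t -> t <= pi -> `|f s - f t| <= c * (t - s)) ->
  forall s t, `|f s - f t| <= c * `|s - t|.
Proof.
move=> pf lf s t; have pi0 : 0 < pi :> R := pi_gt0 R.
have c0 : 0 <= c.
  have : 0 <= c * (pi - - pi).
    by apply: le_trans (lf _ _ (lexx _) _ (lexx _)) => //; lra.
  by rewrite pmulr_lge0//; lra.
wlog st : s t / s <= t.
  move=> H; case: (leP s t) => [|/ltW] /H //.
  by rewrite distrC (distrC s).
wlog /andP[s1 s2] : s t st / - pi <= s <= pi.
  have [m ms] := mod_2pi s => H.
  have := H (s + 2 * pi * m%:~R) (t + 2 * pi * m%:~R).
  rewrite !(@periodicz f)// (_ : s + _ - _ = s - t); last by ring.
  by apply => //; lra.
(* Moving [t] back by whole turns into [[s, s + 2 pi]] keeps [f t] and shortens the distance. *)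
wlog t2 : t st / t <= s + 2 * pi.
  have [m /andP[m1 m2]] := mod_2pi (t - s - pi) => H.
  have [tle|tgt] := leP t (s + 2 * pi); first exact: H.
  have := H (t + 2 * pi * m%:~R); rewrite (@periodicz f)// => Hm.
  apply: le_trans (Hm _ _) _; [lra|lra|].
  rewrite ler_wpM2l// ler0_norm; last by lra.
  by rewrite ler0_norm; lra.
rewrite (@ler0_norm _ (s - t)); last by lra.
have [tpi|tpi] := leP t pi; first by apply: le_trans (lf _ _ _ _ _) _ => //; lra.
have fpi : f (- pi) = f pi by rewrite -(pf (- pi)); congr f; lra.
have ft : f t = f (t - 2 * pi) by rewrite -(pf (_ - _)); congr f; lra.
have := lf s pi s1 s2 (lexx _).
have := lf (- pi) (t - 2 * pi) (lexx _); rewrite -ft fpi => /(_ _ _).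
move=> H1 H2; apply: le_trans (ler_distD (f pi) _ _) _.
apply: le_trans (lerD H2 (H1 _ _)) _; lra.
Qed.

End periodicity.

(** * A law common to the tent and its smoothings *)

Section coupling_law.
Context {R : realType}.
Implicit Types (a b d rho : R) (g q : R -> R).

(* The features common to the tent and its smoothings: [rho] bounds the short
   range, beyond which [g] is affine with slope [- b] through the antipode; the
   bound on [rho] keeps a chain of N agents with gaps [rho] in a half circle. *)
Record coupling_law N a b rho g : Prop := CouplingLaw {
  law_b : 0 < b;
  law_rho : 0 <= rho;
  law_half_circle : (N%:R - 1) * rho < pi;
  law_odd : forall t, g (- t) = - g t;
  law_periodic : periodic g (pi *+ 2);
  law_lipschitz : forall s t, `|g s - g t| <= a * `|s - t|;
  law_far : forall t, rho <= t <= 2 * pi - rho -> g t = b * (pi - t);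
  law_pos : forall t, 0 < t < pi -> 0 < g t }.

Section tent.
Variables (N : nat) (a : R).
Hypotheses (hN : (2 <= N)%N) (ha : 0 < a).
Let p : R := pi / N%:R.
Let b : R := a / (N%:R - 1).

Let N2 : 2 <= N%:R :> R. Proof. by rewrite ler_nat. Qed.
Let p_gt0 : 0 < p. Proof. by rewrite divr_gt0 ?pi_gt0//; move: N2; lra. Qed.
Let Np : N%:R * p = pi. Proof. by rewrite /p mulrCA divff ?mulr1//; move: N2; lra. Qed.
Let b_gt0 : 0 < b. Proof. by rewrite divr_gt0//; move: N2; lra. Qed.
Let Nb : (N%:R - 1) * b = a. Proof. by rewrite /b mulrCA divff ?mulr1//; move: N2; lra. Qed.
Let b_le : b <= a. Proof. rewrite -Nb ler_peMl ?(ltW b_gt0)//; move: N2; lra. Qed.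
(** Continuity of the tent at its corner: [a p = b (pi - p)]. *)
Let bp : b * pi = (a + b) * p. Proof. rewrite -Np -Nb; ring. Qed.
Let p_le : 2 * p <= pi. Proof. by rewrite -Np; apply: ler_wpM2r N2; exact: ltW. Qed.

Lemma tent_left t : t <= - p -> tent N a t = - b * (pi + t).
Proof. by rewrite /tent -/p -/b => ->. Qed.

Lemma tent_mid t : - p <= t <= p -> tent N a t = a * t.
Proof.
rewrite /tent -/p -/b => /andP[h ->]; case: ifPn => // h'.
have -> : t = - p by apply/eqP; rewrite eq_le h h'.
by move: bp; lra.
Qed.

Lemma tent_right t : p <= t -> tent N a t = b * (pi - t).
Proof.
rewrite /tent -/p -/b => h; case: ifPn => h'; first by move: p_gt0; lra.
case: ifPn => // h''.
have -> : t = p by apply/eqP; rewrite eq_le h h''.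
by move: bp; lra.
Qed.

Lemma tent_odd t : tent N a (- t) = - tent N a t.
Proof.
have [h|h] := leP t (- p).
  by rewrite tent_right ?tent_left//; lra.
have [h'|h'] := leP t p; first by rewrite !tent_mid; lra.
by rewrite tent_left ?tent_right//; lra.
Qed.

(** All slopes are at most [a] in absolute value, since [b <= a]; across branches, the increments up
    to the corners add up. *)
Lemma tent_lipschitz s t : s <= t ->
  `|tent N a s - tent N a t| <= a * (t - s).
Proof.
move=> st; have bpE := bp; have p0 := p_gt0.
have mono u : 0 <= u -> 0 <= b * u <= a * u.
  by move=> u0; rewrite mulr_ge0 ?(ltW b_gt0)// ler_wpM2r.
have ap : 0 <= a * p by apply: mulr_ge0; exact: ltW.
have ge0 u : 0 <= u -> 0 <= a * u by move=> u0; apply: mulr_ge0 => //; exact: ltW.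
rewrite ler_norml.
have [s1|s1] := leP s (- p).
  rewrite [tent N a s]tent_left//.
  have := mono (- s - p).
  have [t1|t1] := leP t (- p).
    rewrite tent_left//; have := mono (t - s); lra.
  have [t2|t2] := leP t p.
    by rewrite tent_mid; have := ge0 (t + p); lra.
  by rewrite tent_right; have := mono (t - p); lra.
have [s2|s2] := leP s p.
  rewrite [tent N a s]tent_mid; last by lra.
  have [t2|t2] := leP t p.
    by rewrite tent_mid; have := ge0 (t - s); lra.
  rewrite tent_right; have := mono (t - p); have := ge0 (p - s); lra.
rewrite !tent_right; have := mono (t - s); lra.
Qed.

Lemma tent_gt0 t : 0 < t < pi -> 0 < tent N a t.
Proof.
move=> /andP[t0 tpi]; have [h|h] := leP t p.
  by rewrite tent_mid ?mulr_gt0//; move: p_gt0; lra.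
rewrite tent_right ?(ltW h)// mulr_gt0 ?b_gt0 ?subr_gt0//.
Qed.

(* The slope of the far branch extends across the antipode by periodicity and
   oddness. *)
Lemma periodic_far rho g : p <= rho -> (forall t, g (- t) = - g t) ->
  periodic g (pi *+ 2) -> (forall t, rho <= t <= pi -> g t = tent N a t) ->
  forall t, rho <= t <= 2 * pi - rho -> g t = b * (pi - t).
Proof.
move=> prho og pg gt t /andP[t1 t2]; have [h|h] := leP t pi.
  by rewrite gt ?tent_right//; lra.
rewrite -(@periodicz _ g t (-1))// mulrN1z -[_ + _]opprK og gt ?tent_right; lra.
Qed.

Lemma unsmoothed_law g : unsmoothed N a g -> coupling_law N a b p g.
Proof.
move=> [pg gE]; have og : forall t, g (- t) = - g t.
  by apply: periodic_odd => // t t1; rewrite !gE ?tent_odd//; lra.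
have p0 := p_gt0; have p2 := p_le; have NpE := Np; have n2 := N2; split => //.
- exact: ltW.
- by rewrite mulrBl NpE; lra.
- by apply: periodic_lipschitz => // s t s1 st t1; rewrite !gE ?tent_lipschitz//; lra.
- by apply: periodic_far => // t ?; rewrite gE//; lra.
- by move=> t ?; rewrite gE ?tent_gt0//; lra.
Qed.

(** [rho] is the end [p + d] of the rounded zone. The bound on [d] gives [(N - 1) rho < pi] and
    keeps [g] positive in that zone, where only the slope is controlled. *)
Lemma smoothed_law g : smoothed N a g ->
  exists rho, coupling_law N a b rho g.
Proof.
move=> [d /andP[d0 dlt] [og pg dg cg gE sg]].
have {}gE (t : R) : - pi <= t <= pi -> d <= `| `|t| - p| -> g t = tent N a t.
  exact: gE.
have {}sg (t : R) : - b <= derive1 g t <= a := sg t.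
have Dg (t : R) : is_derive t 1 g (derive1 g t).
  by rewrite derive1E; exact: derivableP (dg t).
have p0 := p_gt0; have p2 := p_le; have NpE := Np; have n2 := N2.
have dN : 2 * (N%:R - 1) * d < p.
  have : d * (2 * N%:R * (N%:R - 1)) < pi.
    by rewrite -ltr_pdivlMr// !mulr_gt0//; lra.
  rewrite -NpE (_ : d * _ = N%:R * (2 * (N%:R - 1) * d)); last ring.
  by rewrite ltr_pM2l//; lra.
have d2p : 2 * d < p by nra.
have pd : p + d < pi by lra.
have lip s t : `|g s - g t| <= a * `|s - t|.
  apply: derive_bound_lipschitz Dg _ => x.
  have /andP[sx sx'] := sg x; rewrite ler_norml sx' andbT.
  by apply: le_trans sx; rewrite lerN2.
exists (p + d); split => //.
- lra.
- rewrite mulrDr mulrBl NpE; lra.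
- apply: periodic_far => //; first lra.
  by move=> t /andP[t1 t2]; rewrite gE//; [lra|rewrite (@ger0_norm _ t) ?ger0_norm; lra].
- move=> t tpi; move: (tpi) => /andP[t0 tp].
  have [far|] := leP d `| `|t| - p|.
    by rewrite gE ?tent_gt0//; lra.
  rewrite (ger0_norm (ltW t0)) ltr_norml => /andP[t1 t2].
  (* A line of slope [- b] from the left end of the rounded zone and one of slope [a] to its right
     end bound [g] from below on the two halves; at [p] both have height [a p - (a + b) d]. *)
  have key : (a + b) * d < a * p.
    have : (a + b) * d = N%:R * d * b by rewrite -Nb; ring.
    have : a * p = (N%:R - 1) * p * b by rewrite -Nb; ring.
    by move=> -> ->; rewrite ltr_pM2r//; nra.
  have bpE := bp.
  have [tlep|tgtp] := leP t p.
  + have gl : g (p - d) = a * (p - d).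
      rewrite gE ?tent_mid; [by []|lra|lra|].
      by rewrite (@ger0_norm _ (p - d)) ?ler0_norm; lra.
    have : 0 <= b * (p - t) by apply: mulr_ge0; [exact: ltW|lra].
    suff : - b * t - g t <= - b * (p - d) - g (p - d) by rewrite gl; lra.
    apply: (@derive_le0_le _ ( *%R (- b) - g) (fun x : R => - b - derive1 g x)).
    - lra.
    - by move=> x; apply: is_deriveB; exact: is_derive_linear.
    - by move=> x _; have := sg x; lra.
  + have gr : g (p + d) = b * (pi - (p + d)).
      rewrite gE ?tent_right; [by []|lra|lra|].
      by rewrite (@ger0_norm _ (p + d)) ?ger0_norm; lra.
    have : 0 <= a * (t - p) by apply: mulr_ge0; [exact: ltW|lra].
    suff : g (p + d) - a * (p + d) <= g t - a * t by rewrite gr; lra.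
    apply: (@derive_le0_le _ (g - *%R a) (fun x : R => derive1 g x - a)).
    - lra.
    - by move=> x; apply: is_deriveB; exact: is_derive_linear.
    - by move=> x _; have := sg x; lra.
Qed.

End tent.
End coupling_law.

(** * The squared distance [q] on the circle *)

Section squared_distance.
Context {R : realType} {N : nat} {a b rho : R} {g q : R -> R}.
Hypotheses (hN : (2 <= N)%N) (ha : 0 < a).
Hypotheses (lg : coupling_law N a b rho g) (hq : squared_distance g q).
Implicit Types s t : R.

Lemma law_0 : g 0 = 0.
Proof. by have := law_odd lg 0; rewrite oppr0 => ?; lra. Qed.

Lemma law_rho_lt_pi : rho < pi.
Proof.
have := law_half_circle lg; have := law_rho lg.
have : 2 <= N%:R :> R by rewrite ler_nat.
nra.
Qed.

Lemma law_bound t : `|g t| <= a * pi.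
Proof.
have [m mt] := mod_2pi t; rewrite -(@periodicz _ g t m); last exact: law_periodic lg.
rewrite -[g _]subr0 -law_0 (le_trans (law_lipschitz lg _ _))//.
by rewrite ler_wpM2l ?(ltW ha)// subr0 ler_norml.
Qed.

(** The antipode has to be left out, since [g] vanishes there too. *)
Lemma law_eq0 t : - pi < t < pi -> g t = 0 -> t = 0.
Proof.
move=> /andP[t1 t2]; case: (ltgtP t 0) => // t0 gt0.
  by have := law_pos lg (t := - t); rewrite (law_odd lg); lra.
by have := law_pos lg (t := t); lra.
Qed.

Lemma law_le0 t : - pi < t <= 0 -> g t <= 0.
Proof.
move=> /andP[t1]; rewrite le_eqVlt => /predU1P[->|t0]; first by rewrite law_0.
by have := law_pos lg (t := - t); rewrite (law_odd lg); lra.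
Qed.

Lemma sqd_lipschitz s t : `|q s - q t| <= a * pi * `|s - t|.
Proof. exact: derive_bound_lipschitz (sqd_derive hq) law_bound. Qed.

(** [q t] is [t] times a value of [g] strictly between [0] and [t], which is positive even for
    [t = pi]. *)
Lemma sqd_gt0 t : 0 < t <= pi -> 0 < q t.
Proof.
move=> /andP[t0 tpi].
have [|x|x] := @MVT R q g 0 t t0; first by move=> x _; exact: (sqd_derive hq).
  by move: x; exact: derive_within_continuous (sqd_derive hq).
rewrite in_itv /= (sqd_0 hq) !subr0 => /andP[x0 xt] ->.
by rewrite mulr_gt0// (law_pos lg)// x0 (lt_le_trans xt).
Qed.

Lemma sqd_gt0_norm t : t != 0 -> `|t| <= pi -> 0 < q t.
Proof.
move=> t0; rewrite ler_norml => /andP[t1 t2].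
case: (ltgtP t 0) t0 => // t0 _; last by apply: sqd_gt0; lra.
by rewrite -(sqd_even hq); apply: sqd_gt0; lra.
Qed.

Lemma sqd_2pi (m : int) : q (2 * pi * m%:~R) = 0.
Proof.
by rewrite -[_ * _]add0r periodicz ?(sqd_0 hq)//; exact: sqd_periodic hq.
Qed.

Lemma sqd_ge0 t : 0 <= q t.
Proof.
have [m mt] := mod_2pi t; rewrite -(@periodicz _ q t m); last exact: sqd_periodic hq.
have [->|t0] := eqVneq (t + 2 * pi * m%:~R) 0; first by rewrite (sqd_0 hq).
by rewrite ltW// sqd_gt0_norm// ler_norml.
Qed.

Lemma sqd_eq0 t : q t = 0 -> exists m : int, t = 2 * pi * m%:~R.
Proof.
have [m mt] := mod_2pi t; rewrite -(@periodicz _ q t m); last exact: sqd_periodic hq.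
have [t0 _|t0] := eqVneq (t + 2 * pi * m%:~R) 0.
  by exists (- m); rewrite mulrNz; lra.
by move=> q0; have := sqd_gt0_norm t0; rewrite q0 ltxx ler_norml mt => /(_ isT).
Qed.

(** On the far range [g] is affine with slope [- b], so [q] plus [b / 2 * (pi - x) ^+ 2] is constant
    there and the expansion is exact. *)
Lemma sqd_far s t : rho <= t <= 2 * pi - rho -> rho <= t + s <= 2 * pi - rho ->
  q (t + s) = q t + s * g t - b / 2 * s ^+ 2.
Proof.
move=> ht hts; rewrite (law_far lg)//.
pose h x := q x + b / 2 * (pi - x) ^+ 2.
have Dh (x : R) : is_derive x 1 h (g x - b * (pi - x)).
  have D1 : is_derive x 1 (cst pi - id : R -> R) (0 - 1) by exact: is_deriveB.
  have D2 := is_deriveZ (b / 2) (@is_deriveX _ _ _ 2 _ _ _ D1).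
  apply: is_derive_eq (is_deriveD (sqd_derive hq x) D2) _.
  by rewrite /GRing.scale /= !fctE expr1; lra.
have h_const u v : rho <= u -> u <= v -> v <= 2 * pi - rho -> h u = h v.
  move=> ru uv vr; apply: (derive_eq0_const uv Dh) => x ?.
  by rewrite (law_far lg) ?subrr//; lra.
suff : h t = h (t + s) by rewrite /h; lra.
by have [st|st] := leP t (t + s); [apply: h_const|apply/esym/h_const]; lra.
Qed.

Lemma sqd_far_mod t : (forall m : int, rho < `|t + 2 * pi * m%:~R|) ->
  exists2 r, 0 < r & forall s, `|s| <= r ->
    q (t + s) = q t + s * g t - b / 2 * s ^+ 2.
Proof.
move=> far.
(* The representative in [[-pi, pi]] serves if it is nonnegative; otherwise one turn is added. *)
have [m mt] : exists m : int, rho < t + 2 * pi * m%:~R < 2 * pi - rho.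
  have [m mt] := mod_2pi t; have := far m; have := law_rho_lt_pi.
  have [t0|t0] := leP 0 (t + 2 * pi * m%:~R).
    by rewrite ger0_norm// => *; exists m; lra.
  by rewrite ltr0_norm// => *; exists (m + 1); rewrite intrD; lra.
have [u [Eq Es Eg] {m}mt] : exists2 u, [/\ q t = q u,
    (forall s, q (t + s) = q (u + s)) & g t = g u] & rho < u < 2 * pi - rho.
  exists (t + 2 * pi * m%:~R) => //; split=> [|s|].
  - by rewrite periodicz//; exact: sqd_periodic hq.
  - by rewrite addrAC periodicz//; exact: sqd_periodic hq.
  - by rewrite periodicz//; exact: law_periodic lg.
(* The margin left to both ends of the far range. *)
exists (Num.min (u - rho) (2 * pi - rho - u)); first by rewrite lt_min; lra.
move=> s; rewrite le_min !ler_norml => /andP[/andP[s1 s2] /andP[s3 s4]].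
by rewrite Eq Es Eg sqd_far; lra.
Qed.

End squared_distance.

(** * Lipschitz maps and row vectors *)

Lemma lipschitz_continuous (R : realType) (U W : normedModType R) (h : U -> W) (c : R) :
  (forall x y, `|h x - h y| <= c * `|x - y|) -> continuous h.
Proof.
move=> hL x A /= /(nbhs_ballP (h x)) [eps /= eps0 epsA].
have c0 : 0 < `|c| + 1 by apply: ltr_wpDl.
apply/nbhs_ballP; exists (eps / (`|c| + 1)) => /=; first exact: divr_gt0.
move=> y; rewrite -ball_normE /= ltr_pdivlMr// mulrC => xy; apply: epsA.
rewrite -ball_normE /=; apply: le_lt_trans xy.
apply: le_trans (hL _ _) _; apply: ler_wpM2r => //.
by apply: le_trans (ler_norm _) _; rewrite lerDl.
Qed.

Section row_vectors.
Context {R : realType} {N : nat}.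
Implicit Types (x y v : 'rV[R]_N).

Lemma coord_le_norm x k : `|x 0 k| <= `|x|.
Proof. by rewrite [leRHS]/Num.Def.normr /= mx_normrE; exact: (le_bigmax _ _ (0, k)). Qed.

Lemma norm_rV_le x (c : R) : 0 <= c -> (forall k, `|x 0 k| <= c) -> `|x| <= c.
Proof.
move=> c0 xc; rewrite [leLHS]/Num.Def.normr /= mx_normrE bigmax_le// => -[i k] _ /=.
by rewrite ord1.
Qed.

Lemma ball_rVE x (eps : R) y : ball x eps y = (`|x - y| < eps) :> Prop.
Proof. by rewrite -ball_normE. Qed.

Lemma is_derive_coord (x : R -> 'rV[R]_N) (t : R) v k :
  is_derive t 1 x v -> is_derive t 1 (fun s => x s 0 k) (v 0 k).
Proof.
move=> [dx <-]; have dxk := (derivable_mxP x t 1).1 dx 0 k.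
by apply: DeriveDef => //; rewrite derive_mx// mxE.
Qed.

Lemma is_derive_row (x : R -> 'rV[R]_N) (t : R) v :
  (forall k, is_derive t 1 (fun s => x s 0 k) (v 0 k)) -> is_derive t 1 x v.
Proof.
move=> dx; have dx' : derivable x t 1.
  by apply/derivable_mxP => i k; rewrite ord1; have [] := dx k.
apply: DeriveDef => //; rewrite derive_mx//; apply/rowP => k; rewrite mxE.
by have [_] := dx k.
Qed.

End row_vectors.

(** * Vector field and potential of the network *)

Section network.
Context {R : realType} {N : nat} {e : rel 'I_N} {a b rho : R} {g q : R -> R}.
Hypotheses (hN : (2 <= N)%N) (he : connected_graph e) (ha : 0 < a).
Hypotheses (lg : coupling_law N a b rho g) (hq : squared_distance g q).
Implicit Types (x y v : 'rV[R]_N).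

Let f := velocity e g.
Let V := potential e q.

(** Summation by parts on the graph: exchanging the ends of the edges, with [g] odd, makes the two
    halves of the sum equal. It yields both the chain rule for [V] and the first-order term at an
    equilibrium. *)
Lemma edge_pairing x v :
  2^-1 * \sum_k \sum_(j | e k j) g (x 0 j - x 0 k) * (v 0 j - v 0 k)
  = - \sum_k v 0 k * f x 0 k.
Proof.
have [es _ _] := he.
have E : \sum_k \sum_(j | e k j) g (x 0 j - x 0 k) * v 0 k =
    \sum_k v 0 k * f x 0 k.
  by apply: eq_bigr => k _; rewrite mxE mulr_sumr; apply: eq_bigr => j _; rewrite mulrC.
under eq_bigr do under eq_bigr do rewrite mulrBr.
under eq_bigr do rewrite big_split /= sumrN.
rewrite big_split /= sumrN E (exchange_big_dep predT)//=.
under eq_bigr => k _.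
  under eq_bigl do rewrite es.
  under eq_bigr => j _ do rewrite -opprB (law_odd lg) mulNr.
  rewrite sumrN.
  over.
by rewrite sumrN E; lra.
Qed.

Section shift.
Variables (x y : 'rV[R]_N) (c : R) (m : 'I_N -> int).
Hypothesis yE : forall k, y 0 k = x 0 k + c + 2 * pi * (m k)%:~R.

(** The rotation [c] cancels in differences, leaving whole turns. *)
Lemma periodic_shift (h : R -> R) j k : periodic h (pi *+ 2) ->
  h (y 0 j - y 0 k) = h (x 0 j - x 0 k).
Proof.
move=> ph; rewrite -(@periodicz _ h (x 0 j - x 0 k) (m j - m k))//.
by congr h; rewrite !yE intrB; ring.
Qed.

Lemma velocity_shift : f y = f x.
Proof.
apply/rowP => k; rewrite !mxE; apply: eq_bigr => j _.
by apply: periodic_shift; exact: law_periodic lg.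
Qed.

Lemma potential_shift : V y = V x.
Proof.
congr (_ * _); apply: eq_bigr => k _; apply: eq_bigr => j _.
by apply: periodic_shift; exact: sqd_periodic hq.
Qed.

End shift.

Lemma norm_coordB x y j k :
  `|(x 0 j - x 0 k) - (y 0 j - y 0 k)| <= 2 * `|x - y|.
Proof.
have := coord_le_norm (x - y) j; have := coord_le_norm (x - y) k.
rewrite !mxE => hk hj.
rewrite (_ : _ - _ - _ = (x 0 j - y 0 j) - (x 0 k - y 0 k)); last by ring.
by apply: le_trans (ler_normB _ _) _; lra.
Qed.

Lemma edge_sum_le (h : 'I_N -> R) (c : R) k : 0 <= c ->
  (forall j, `|h j| <= c) -> `|\sum_(j | e k j) h j| <= N%:R * c.
Proof.
move=> c0 hc; apply: le_trans (ler_norm_sum _ _ _) _.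
apply: (@le_trans _ _ (\sum_(j < N) c)); last first.
  by rewrite sumr_const card_ord mulr_natl.
rewrite big_mkcond; apply: ler_sum => j _.
by case: ifP.
Qed.

Lemma velocity_bound x k : `|f x 0 k| <= N%:R * (a * pi).
Proof.
rewrite mxE; apply: edge_sum_le => [|j]; first by rewrite mulr_ge0 ?pi_ge0 ?(ltW ha).
exact: (law_bound ha lg).
Qed.

Lemma velocity_lipschitz x y k :
  `|f x 0 k - f y 0 k| <= N%:R * (a * (2 * `|x - y|)).
Proof.
rewrite !mxE -sumrB; apply: edge_sum_le => [|j].
  by rewrite !mulr_ge0// ltW.
apply: le_trans (law_lipschitz lg _ _) _.
  by apply: ler_wpM2l; [exact: ltW|exact: norm_coordB].
Qed.

Lemma potential_lipschitz : exists2 c, 0 < c &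
  forall x y, `|V x - V y| <= c * `|x - y|.
Proof.
(* There are at most [N ^ 2] ordered edges, [q] is [a pi]-Lipschitz, and a difference of coordinates
   varies at most twice as much as the vector. *)
exists (2^-1 * (N%:R * (N%:R * (a * pi * 2)))).
  by rewrite !mulr_gt0 ?pi_gt0 ?ltr0n//; apply: leq_trans hN.
move=> x y; rewrite -mulrBr -sumrB normrM -[leRHS]mulrA (@gtr0_norm _ 2^-1)// ler_pM2l//.
under eq_bigr do rewrite -sumrB.
apply: le_trans (ler_norm_sum _ _ _) _.
apply: (@le_trans _ _ (\sum_(k < N) N%:R * (a * pi * (2 * `|x - y|)))).
  apply: ler_sum => k _; apply: edge_sum_le => [|j].
    by rewrite !mulr_ge0 ?pi_ge0 ?(ltW ha).
  apply: le_trans (sqd_lipschitz ha lg hq _ _) _.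
  by rewrite ler_wpM2l ?norm_coordB// mulr_ge0 ?pi_ge0 ?(ltW ha).
by rewrite sumr_const card_ord -mulr_natl; lra.
Qed.

Lemma potential_continuous : continuous V.
Proof. by have [c _ /lipschitz_continuous] := potential_lipschitz. Qed.

Lemma potential_ge0 x : 0 <= V x.
Proof.
rewrite mulr_ge0//; apply: sumr_ge0 => k _; apply: sumr_ge0 => j _.
exact: (sqd_ge0 lg hq).
Qed.

Lemma sum_edges_eq0 (h : 'I_N -> 'I_N -> R) : (forall j k, 0 <= h j k) ->
  \sum_k \sum_(j | e k j) h k j = 0 -> forall k j, e k j -> h k j = 0.
Proof.
move=> h0 /eqP; rewrite psumr_eq0; last by move=> k _; exact: sumr_ge0.
move=> /allP H k j ekj; have /implyP /(_ isT) := H k (mem_index_enum _).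
rewrite psumr_eq0// => /allP /(_ j (mem_index_enum _)).
by rewrite ekj => /eqP.
Qed.

(** Carries a relation from edges to all pairs along paths. It serves for equality modulo [2 pi],
    for being a foremost agent and for membership in a cut. *)
Lemma connected_eqrel (r : 'I_N -> 'I_N -> Prop) : (forall i, r i i) ->
  (forall i j k, r i j -> r j k -> r i k) -> (forall i j, e i j -> r i j) ->
  forall i j, r i j.
Proof.
move=> rr rt er i j; have [_ _ /(_ i j) /connectP[p]] := he.
elim: p i => [|k p IH] i /=; first by move=> _ ->.
by move=> /andP[/er rik /IH pk] /pk; exact: rt.
Qed.

Lemma potential_eq0 x : V x = 0 <-> synchronized x.
Proof.
split=> [V0 i j|sx]; last first.
  rewrite /V /potential; under eq_bigr => k _.
    under eq_bigr => j _.
      have [m ->] := sx j k; rewrite (sqd_2pi hq); over.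
    rewrite big1//; over.
  by rewrite big1// mulr0.
apply: (connected_eqrel (r := fun i j => exists m : int, x 0 i - x 0 j = 2 * pi * m%:~R)).
- by move=> k; exists 0; rewrite subrr mulr0.
- move=> k1 k2 k3 [m1 E1] [m2 E2]; exists (m1 + m2).
  by rewrite intrD mulrDr -E1 -E2; ring.
- move=> k1 k2 ek.
  have S0 : \sum_k \sum_(j | e k j) q (x 0 j - x 0 k) = 0.
    by move: V0 => /eqP; rewrite mulf_eq0 invr_eq0 pnatr_eq0 /= => /eqP.
  apply: (sqd_eq0 lg hq); rewrite -opprB (sqd_even hq).
  exact: (sum_edges_eq0 (h := fun k j => q (x 0 j - x 0 k)) (fun _ _ => sqd_ge0 lg hq _) S0).
Qed.

(** Stated for any curve, so that it gives the derivative of [V] along a solution as well as its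
    partial derivatives. *)
Lemma is_derive_potential (y : R -> 'rV[R]_N) (t : R) v :
  (forall k, is_derive t 1 (fun s => y s 0 k) (v 0 k)) ->
  is_derive t 1 (V \o y) (- \sum_k v 0 k * f (y t) 0 k).
Proof.
move=> Dy; rewrite -edge_pairing.
have -> : V \o y = 2^-1 \*: (\sum_k \sum_j if e k j then
    (q \o ((fun s => y s 0 j) - (fun s => y s 0 k))) else cst 0).
  apply/funext => s; rewrite /V /potential /= fctE; congr (_ * _).
  rewrite fct_sumE; apply: eq_bigr => k _.
  by rewrite fct_sumE big_mkcond; apply: eq_bigr => j _; case: ifP.
apply: is_deriveZ; apply: is_derive_sum => k; rewrite [X in is_derive _ _ _ X]big_mkcond /=.
apply: is_derive_sum => j; case: ifP => _; last exact: is_derive_cst.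
by apply: is_derive1_comp; exact: (sqd_derive hq).
Qed.

Lemma potential_differentiable x : differentiable V x.
Proof.
have -> : V = 2^-1 \*: (\sum_k \sum_j if e k j then
    (q \o ((fun y : 'rV[R]_N => y 0 j) - (fun y => y 0 k))) else cst 0).
  apply/funext => s; rewrite /V /potential /= fctE; congr (_ * _).
  rewrite fct_sumE; apply: eq_bigr => k _.
  by rewrite fct_sumE big_mkcond; apply: eq_bigr => j _; case: ifP.
apply: differentiableZ; apply: differentiable_sum => k.
apply: differentiable_sum => j; case: ifP => _; last exact: differentiable_cst.
apply: differentiable_comp.
  by apply: differentiableB; exact: differentiable_coord.
by apply/derivable1_diffP; have [] := sqd_derive hq (x 0 j - x 0 k).
Qed.

(** A partial derivative is the derivative of [V] along a coordinate line through [x]. *)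
Lemma gradient_potential x : gradient V x = - f x.
Proof.
apply/rowP => k; rewrite !mxE.
have -> : 'D_(delta_mx 0 k) V x =
    'D_1 (V \o (fun s : R => s *: delta_mx 0 k + x)) 0.
  rewrite /derive /=; under [in RHS]eq_fun => h.
    rewrite scale0r add0r addr0 [h *: 1]mulr1; over.
  by [].
have D j : is_derive (0 : R) 1 (fun s : R => (s *: delta_mx 0 k + x) 0 j)
    ((delta_mx 0 k : 'rV[R]_N) 0 j).
  have -> : (fun s : R => (s *: delta_mx 0 k + x) 0 j) =
      *%R ((delta_mx 0 k : 'rV[R]_N) 0 j) + cst (x 0 j).
    by apply/funext => s; rewrite fctE !mxE mulrC.
  rewrite -[X in is_derive _ _ _ X]addr0.
  have ? := is_derive_linear ((delta_mx 0 k : 'rV[R]_N) 0 j) 0.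
  exact: is_deriveD.
have [_ ->] := is_derive_potential D.
rewrite scale0r add0r (bigD1 k)//= big1 ?addr0.
  by rewrite mxE !eqxx mul1r mxE.
by move=> j /negPf jk; rewrite mxE eqxx jk mul0r.
Qed.

Lemma equilibria_critical : equilibria e g = critical_points V.
Proof.
apply/seteqP; split=> x /=; rewrite /critical_points /equilibria /= gradient_potential.
  by move=> fx; split; [exact: potential_differentiable|rewrite /f fx oppr0].
by move=> [_ /eqP]; rewrite oppr_eq0 => /eqP.
Qed.

End network.

(** * Compactness of the torus, seen through lifts *)

Section torus.
Context {R : realType} {N : nat}.
Implicit Types (x y : 'rV[R]_N) (A : set 'rV[R]_N) (m : 'I_N -> int).

(** The deck transformation of the covering of the torus by [R^N], with winding numbers [m]. *)
Definition torus_shift m x : 'rV[R]_N := \row_k (x 0 k + 2 * pi * (m k)%:~R).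

Lemma torus_shiftNK m x : torus_shift (fun k => - m k) (torus_shift m x) = x.
Proof. by apply/rowP => k; rewrite !mxE mulrNz mulrN addrK. Qed.

Lemma torus_shiftB m x y : torus_shift m x - torus_shift m y = x - y.
Proof. by apply/rowP => k; rewrite !mxE; ring. Qed.

Lemma torus_shift_box x : exists m, forall k, `|torus_shift m x 0 k| <= pi.
Proof.
have /choice[m mx] : forall k, exists m : int, - pi <= x 0 k + 2 * pi * m%:~R <= pi.
  by move=> k; exact: mod_2pi.
by exists m => k; rewrite mxE ler_norml.
Qed.

Lemma open_neighborhood A eps : open (neighborhood A eps).
Proof. by apply: bigcup_open => y _; exact: ball_open. Qed.

Lemma closed_box (c : R) : closed [set x : 'rV[R]_N | forall k, `|x 0 k| <= c].
Proof.
have -> : [set x : 'rV[R]_N | forall k, `|x 0 k| <= c] =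
    \bigcap_k ((fun x : 'rV[R]_N => x 0 k) @^-1` `[- c, c]).
  apply/seteqP; split=> x /= H k; first by move=> _ /=; rewrite in_itv /= -ler_norml.
  by have := H k I; rewrite /= in_itv /= -ler_norml.
apply: closed_bigI => k _; apply: closed_comp; last exact: interval_closed.
by move=> x _; exact: coord_continuous.
Qed.

(** By invariance it suffices to look at the box [[-pi, pi]^N]. Its part [K] outside the
    neighborhood is compact, so [h] has a minimum on it, positive because the zeros of [h] lie in
    [A]; this minimum is [d]. *)
Lemma torus_sublevel (h : 'rV[R]_N -> R) A eps : 0 < eps ->
  continuous h -> (forall x, 0 <= h x) ->
  (forall m x, h (torus_shift m x) = h x) ->
  (forall m x, A x -> A (torus_shift m x)) ->
  (forall x, h x = 0 -> A x) ->
  exists2 d, 0 < d & forall x, h x < d -> neighborhood A eps x.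
Proof.
move=> eps0 ch h0 hs As hA.
pose K := ~` neighborhood A eps `&` [set x | forall k, `|x 0 k| <= pi].
have shiftK x : ~ neighborhood A eps x -> exists2 y, K y & h y = h x.
  move=> nx; have [m mx] := torus_shift_box x.
  exists (torus_shift m x) => //; split=> // -[y Ay].
  rewrite ball_rVE => yx; apply: nx; exists (torus_shift (fun k => - m k) y).
    exact: As.
  by rewrite ball_rVE -(torus_shiftNK m x) torus_shiftB.
have [[x0 Kx0]|K0] := pselect (K !=set0); last first.
  (* If [K] is empty, the neighborhood is everything and any [d] will do. *)
  exists 1 => // x _; apply: contrapT => /shiftK[y Ky _].
  by apply: K0; exists y.
have cK : compact K.
  apply: bounded_closed_compact.
    exists pi; split; first exact: num_real.
    move=> M piM x [_ xM]; apply: le_trans (ltW piM).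
    by apply: norm_rV_le => //; exact: pi_ge0.
  apply: closedI; [exact/open_closedC/open_neighborhood|exact: closed_box].
have [c cK' cmin] := EVT_min_rV (ex_intro _ x0 Kx0) cK (continuous_subspaceT ch).
move: cK'; rewrite inE => -[nc _].
exists (h c).
  rewrite lt_neqAle h0 andbT eq_sym; apply/negP => /eqP /hA Ac.
  by apply: nc; exists c => //; exact: ballxx.
move=> x hx; apply: contrapT => /shiftK[y Ky hy].
by have := cmin y; rewrite inE hy leNgt hx => /(_ Ky).
Qed.

End torus.

(** * Gradient flow: convergence, and stability of synchronization *)

Section dynamics.
Context {R : realType} {N : nat} {e : rel 'I_N} {a b rho : R} {g q : R -> R}.
Hypotheses (hN : (2 <= N)%N) (he : connected_graph e) (ha : 0 < a).
Hypotheses (lg : coupling_law N a b rho g) (hq : squared_distance g q).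
Implicit Types (y z : 'rV[R]_N).

Let f := velocity e g.
Let V := potential e q.
(** The squared norm of the gradient of [V], the rate at which [V] decreases along solutions. *)
Let F (y : 'rV[R]_N) := \sum_k f y 0 k ^+ 2.

Lemma velocity_torus_shift m y : f (torus_shift m y) = f y.
Proof.
by apply: (@velocity_shift _ _ _ _ _ _ _ lg y _ 0 m) => k; rewrite mxE addr0.
Qed.

Lemma potential_torus_shift m y : V (torus_shift m y) = V y.
Proof.
by apply: (@potential_shift _ _ _ _ _ hq y _ 0 m) => k; rewrite mxE addr0.
Qed.

Lemma speed_ge0 y : 0 <= F y.
Proof. by apply: sumr_ge0 => k _; exact: sqr_ge0. Qed.

Lemma speed_eq0 y : F y = 0 -> f y = 0.
Proof.
move=> /eqP; rewrite psumr_eq0 => [/allP H|k _]; last exact: sqr_ge0.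
apply/rowP => k; rewrite [RHS]mxE.
by have := H k (mem_index_enum _); rewrite sqrf_eq0 => /eqP.
Qed.

Lemma speed_lipschitz : exists2 c, 0 < c & forall y z, `|F y - F z| <= c * `|y - z|.
Proof.
exists (N%:R * ((N%:R * (a * 2)) * (2 * (N%:R * (a * pi))))).
  by rewrite !mulr_gt0 ?pi_gt0 ?ltr0n//; apply: leq_trans hN.
move=> y z; rewrite -sumrB; apply: le_trans (ler_norm_sum _ _ _) _.
apply: (@le_trans _ _ (\sum_(k < N)
    (N%:R * (a * (2 * `|y - z|))) * (2 * (N%:R * (a * pi))))); last first.
  by rewrite sumr_const card_ord -mulr_natl; lra.
apply: ler_sum => k _; rewrite subr_sqr normrM ler_pM//.
  exact: (velocity_lipschitz ha lg).
apply: le_trans (ler_normD _ _) _.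
have := velocity_bound (e := e) ha lg y k; have := velocity_bound (e := e) ha lg z k.
by rewrite -/f; lra.
Qed.

Section trajectory.
Variable x : R -> 'rV[R]_N.
Hypothesis sx : solution e g x.
Implicit Types s t : R.

Lemma solution_coord_derive t k : 0 < t ->
  is_derive t 1 (fun u => x u 0 k) (f (x t) 0 k).
Proof. by move=> t0; apply: is_derive_coord; exact: sx.2. Qed.

Lemma solution_within (h : 'rV[R]_N -> R) s t : 0 <= s -> continuous h ->
  {within `[s, t], continuous (h \o x)}.
Proof.
move=> s0 ch; have sub : `[s, t] `<=` `[0, +oo[.
  by move=> u /=; rewrite !in_itv /= => /andP[su _]; rewrite (le_trans s0 su).
apply: (continuous_subspaceW sub); apply: within_continuous_comp sx.1; move=> y _; exact: ch.
Qed.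

Lemma solution_lipschitz s t : 0 <= s -> s <= t ->
  `|x s - x t| <= N%:R * (a * pi) * (t - s).
Proof.
move=> s0 st; apply: norm_rV_le => [|k].
  by rewrite !mulr_ge0 ?pi_ge0 ?(ltW ha) ?subr_ge0.
rewrite !mxE distrC mulrBr.
apply: (@increment_norm_le _ (fun u => x u 0 k) (fun u => f (x u) 0 k) _
  (fun=> N%:R * (a * pi))) => //.
- by move=> u /andP[su _]; apply: solution_coord_derive; exact: le_lt_trans su.
- by move=> u _; exact: is_derive_linear.
- by apply: (solution_within (h := fun y => y 0 k)) => //; exact: coord_continuous.
- by apply: (@derive_within_continuous _ _ (fun=> N%:R * (a * pi))) => u; exact: is_derive_linear.
- by move=> u _; exact: (velocity_bound ha lg).
Qed.

Lemma potential_decrease c s t : 0 <= s -> s <= t ->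
  (forall u, s < u < t -> c <= F (x u)) -> V (x t) <= V (x s) - c * (t - s).
Proof.
move=> s0 st cF.
suff : (V \o x) t - (V \o x) s <= - c * t - - c * s by rewrite /=; lra.
apply: (@increment_le _ _ (fun u => - F (x u)) _ (fun=> - c)) => //.
- move=> u /andP[su _].
  rewrite /F; under eq_bigr do rewrite expr2.
  apply: (is_derive_potential he lg hq) => k.
  by apply: solution_coord_derive; exact: le_lt_trans su.
- by move=> u _; exact: is_derive_linear.
- by apply: solution_within => //; exact: (potential_continuous hN ha lg hq).
- by apply: (@derive_within_continuous _ _ (fun=> - c)) => u; exact: is_derive_linear.
- by move=> u /cF; rewrite lerN2.
Qed.

Lemma potential_nonincreasing s t : 0 <= s -> s <= t -> V (x t) <= V (x s).
Proof.
move=> s0 st; rewrite -[leRHS]subr0 -(mul0r (t - s)).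
by apply: potential_decrease => // u _; exact: speed_ge0.
Qed.

(* [F] is Lipschitz along the trajectory, so each visit to [F >= d] lasts long
   enough to cost a fixed amount of the potential. *)
Lemma speed_vanishes d : 0 < d -> exists2 T, 0 <= T & forall t, T <= t -> F (x t) < d.
Proof.
move=> d0; have [c c0 cF] := speed_lipschitz.
pose L := c * (N%:R * (a * pi)).
have L0 : 0 < L.
  by rewrite !mulr_gt0 ?pi_gt0 ?ltr0n//; apply: leq_trans hN.
(* With Lipschitz constant [L] in time, [F] needs at least the time [tau] to fall from [d] to
   [d / 2]. *)
pose tau := d / 2 / L.
have tau0 : 0 < tau by rewrite !divr_gt0.
have Ltau : L * tau = d / 2 by rewrite /tau mulrC divfK// gt_eqF.
pose E := [set V (x t) | t in [set t | 0 <= t]].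
have lbE : has_lbound E by exists 0 => _ [t _ <-]; exact: (potential_ge0 lg hq).
have infE : has_inf E by split=> //; exists (V (x 0)); exists 0 => //=.
(* From [T] on, [V] is within [d / 2 * tau] of its infimum, so it cannot afford such a visit. *)
have [|_ [T T0 <-] VT] := @inf_adherent _ E (d / 2 * tau) _ infE.
  by rewrite mulr_gt0// divr_gt0.
exists T => // t Tt; rewrite ltNge; apply/negP => dF.
have t0 : 0 <= t := le_trans T0 Tt.
have ttau : t <= t + tau by rewrite lerDl ltW.
have : V (x (t + tau)) <= V (x t) - d / 2 * (t + tau - t).
  apply: potential_decrease => // u /andP[tu ut].
  have H1 := cF (x t) (x u); have H2 := solution_lipschitz t0 (ltW tu).
  have H3 : c * `|x t - x u| <= L * (u - t) by rewrite /L -mulrA ler_pM2l.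
  have H4 : L * (u - t) <= L * tau by rewrite ler_pM2l//; lra.
  have := ler_norm (F (x t) - F (x u)); lra.
have := potential_nonincreasing T0 Tt.
have : inf E <= V (x (t + tau)).
  by apply: ge_inf => //; exists (t + tau) => //=; rewrite addr_ge0// ltW.
by move: VT; rewrite /=; lra.
Qed.

Lemma solution_converges : converges_to x (equilibria e g).
Proof.
move=> eps eps0; have [c _ cF] := speed_lipschitz.
have [|||||d d0 dF] := @torus_sublevel _ _ F (equilibria e g) eps eps0.
- exact: (lipschitz_continuous cF).
- exact: speed_ge0.
- by move=> m y; rewrite /F velocity_torus_shift.
- by move=> m y; rewrite /equilibria /= -/f velocity_torus_shift.
- exact: speed_eq0.
have [T _ FT] := speed_vanishes d0.
exists T; split; first exact: num_real.
by move=> t Tt; apply/dF/FT/ltW.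
Qed.

End trajectory.

(** No neighbor pulls a foremost agent forward, and the pulls sum to zero, so each is zero. Within a
    half circle this puts its neighbors at the same place, and connectivity reaches all agents. *)
Lemma half_circle_equilibrium y : (forall i j, y 0 i - y 0 j < pi) ->
  f y = 0 -> forall i j, y 0 i = y 0 j.
Proof.
move=> ypi fy0.
have i0 : 'I_N := Ordinal (leq_trans (isT : (0 < 2)%N) hN).
have [M _ Mmax] := @Order.TotalTheory.arg_maxP _ R _ i0 predT (fun i => y 0 i) isT.
suff yM : forall j, y 0 j = y 0 M by move=> i j; rewrite !yM.
move=> j; have := @connected_eqrel _ _ he (fun i j => y 0 i = y 0 M -> y 0 j = y 0 M).
apply=> // [i k l rik rkl /rik|i k eik yi]; first exact: rkl.
have : \sum_(l | e i l) - g (y 0 l - y 0 i) = 0.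
  by have /rowP/(_ i) := fy0; rewrite !mxE sumrN => ->; rewrite oppr0.
have lei l : - pi < y 0 l - y 0 i <= 0.
  have yl : y 0 l <= y 0 M := Mmax l isT.
  by have := ypi i l; rewrite yi; lra.
move=> /eqP; rewrite psumr_eq0 => [/allP /(_ k (mem_index_enum _))|l _]; last first.
  by rewrite oppr_ge0 (law_le0 lg).
rewrite eik oppr_eq0 => /eqP /(law_eq0 lg) yki.
have /yki : - pi < y 0 k - y 0 i < pi by have := lei k; have := pi_gt0 R; lra.
by rewrite -yi; lra.
Qed.

(** Identifies neighborhoods of the configuration with those of the zero set of [V]. *)
Lemma synchronized_configuration y : synchronized y ->
  configuration y = [set z | synchronized z].
Proof.
move=> sy; have i0 : 'I_N := Ordinal (leq_trans (isT : (0 < 2)%N) hN).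
apply/seteqP; split=> z /= => [[c [m zE]] i j|sz].
  have [n nE] := sy i j; exists (n + m i - m j).
  by rewrite !zE intrB intrD; lra.
have /choice[n nE] : forall k, exists n : int,
    (z 0 k - z 0 i0) - (y 0 k - y 0 i0) = 2 * pi * n%:~R.
  move=> k; have [n1 ->] := sz k i0; have [n2 ->] := sy k i0.
  by exists (n1 - n2); rewrite intrB mulrBr.
by exists (z 0 i0 - y 0 i0), n => k; rewrite -nE; ring.
Qed.

Lemma synchronized_torus_shift m y : synchronized y -> synchronized (torus_shift m y).
Proof.
move=> sy i j; have [n nE] := sy i j; exists (n + m i - m j).
by rewrite !mxE intrB intrD; lra.
Qed.

Lemma synchronized_equilibrium y : synchronized y -> f y = 0.
Proof.
move=> sy; apply/rowP => k; rewrite !mxE big1// => j _.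
have [m ->] := sy j k; rewrite -[_ * _]add0r periodicz ?(law_0 lg)//.
exact: law_periodic lg.
Qed.

Lemma low_potential_near_sync eps : 0 < eps ->
  exists2 d, 0 < d &
    forall y, V y < d -> neighborhood [set z | synchronized z] eps y.
Proof.
move=> eps0; apply: torus_sublevel => //.
- exact: (potential_continuous hN ha lg hq).
- exact: (potential_ge0 lg hq).
- exact: potential_torus_shift.
- exact: synchronized_torus_shift.
- by move=> y /(potential_eq0 he lg hq).
Qed.

(** Synchronization is isolated among equilibria: an equilibrium close to it lifts to a half
    circle. *)
Lemma low_potential_equilibrium : exists2 d, 0 < d &
  forall y, V y < d -> f y = 0 -> synchronized y.
Proof.
have pi0 := pi_gt0 R; have i0 : 'I_N := Ordinal (leq_trans (isT : (0 < 2)%N) hN).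
have pi4 : 0 < pi / 4 :> R by rewrite divr_gt0.
have [d d0 dV] := low_potential_near_sync pi4.
exists d => // y /dV[z sz]; rewrite ball_rVE => zy fy0.
(* Undoing the winding numbers of [z] puts all agents within [pi / 4] of the single number
   [z 0 i0]. *)
have /choice[m mE] : forall k, exists m : int, z 0 k - z 0 i0 = 2 * pi * m%:~R.
  by move=> k; exact: sz.
have fs : f (torus_shift (fun k => - m k) y) = 0 by rewrite velocity_torus_shift.
have close k : `|torus_shift (fun k => - m k) y 0 k - z 0 i0| < pi / 4.
  apply: le_lt_trans zy; apply: le_trans (coord_le_norm _ k).
  rewrite -[leRHS]normrN le_eqVlt; apply/orP; left; apply/eqP; congr `|_|.
  by rewrite !mxE mulrNz mulrN -mE; ring.
have eqs : forall i j, torus_shift (fun k => - m k) y 0 i = torus_shift (fun k => - m k) y 0 j.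
  apply: half_circle_equilibrium fs => i j.
  by have := close i; have := close j; rewrite !ltr_norml; lra.
move=> i j; exists (m i - m j).
by have := eqs i j; rewrite !mxE !mulrNz intrB; lra.
Qed.

(** Stability holds because sublevel sets of [V] are invariant and shrink to synchronization. For
    attraction, the equilibria that the solution approaches have low potential, hence are
    synchronized. *)
Lemma synchronized_asymptotically_stable y : synchronized y ->
  asymptotically_stable e g y.
Proof.
move=> sy; have [c c0 cV] := potential_lipschitz (e := e) hN ha lg hq.
have Vsync d x : 0 < d -> neighborhood [set z | synchronized z] d x -> V x < c * d.
  move=> d0 [z sz]; rewrite ball_rVE => zx.
  have Vz : V z = 0 by apply/(potential_eq0 he lg hq).
  have := cV x z; rewrite -/V Vz subr0 => H.
  apply: le_lt_trans (ler_norm _) _; apply: le_lt_trans H _.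
  by rewrite ltr_pM2l// distrC.
rewrite /asymptotically_stable (synchronized_configuration sy); split.
- exact: synchronized_equilibrium.
- move=> eps eps0; have [d d0 dV] := low_potential_near_sync eps0.
  exists (d / c); first exact: divr_gt0.
  move=> x sx /Vsync Vx t t0; apply: dV.
  apply: le_lt_trans (potential_nonincreasing sx (lexx 0) t0) _.
  by rewrite -[d](@divfK _ c) ?gt_eqF// mulrC Vx// divr_gt0.
- have [d d0 dV] := low_potential_equilibrium.
  (* One half of [d] bounds [V] along the solution, the other half pays for passing to the nearby
     equilibrium [z]. *)
  have d2 : 0 < d / 2 / c by rewrite !divr_gt0.
  have cd : c * (d / 2 / c) = d / 2 by rewrite mulrC divfK// gt_eqF.
  exists (d / 2 / c) => // x sx /Vsync Vx eps eps0.
  have eps'0 : 0 < Num.min eps (d / 2 / c) by rewrite lt_min eps0.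
  have [T [_ HT]] := solution_converges sx eps'0.
  exists (Num.max T 0); split; first exact: num_real.
  move=> t; rewrite gt_max => /andP[Tt t0].
  have [z ez] := HT t Tt; rewrite ball_rVE lt_min => /andP[zeps zd].
  exists z => //=; last by rewrite ball_rVE.
  apply: dV => //.
  have Vxt := potential_nonincreasing sx (lexx 0) (ltW t0).
  have := cV z (x t); have := ler_norm (V z - V (x t)); rewrite -/V.
  have : c * `|z - x t| < d / 2 by rewrite -cd ltr_pM2l.
  have := Vx d2; rewrite cd; lra.
Qed.

End dynamics.

(** * Global solutions by Picard iteration *)

Section cauchy_lipschitz.
Context {R : realType}.

Lemma antiderivative (h : R -> R) (c : R) : continuous h ->
  exists2 H : R -> R, H 0 = c & forall t : R, 0 <= t -> is_derive t 1 H (h t).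
Proof.
(* Integrating from [-1] makes [0] an interior point, so the derivative exists there too. *)
move=> ch; pose F t := (\int[lebesgue_measure]_(s in `[(-1), t]) h s)%R.
exists (fun t => F t + (c - F 0)); first by rewrite addrC subrK.
move=> t t0.
have t1 : t < t + 1 by rewrite ltrDl.
have Nt : -1 < t by apply: lt_le_trans t0; rewrite oppr_lt0.
have ih : lebesgue_measure.-integrable `[-1, t + 1] (EFin \o h).
  apply: continuous_compact_integrable; first exact: segment_compact.
  exact: continuous_subspaceT.
have [dF F'] := continuous_FTC1_closed t1 ih Nt (ch t).
rewrite -[X in is_derive _ _ _ X]addr0; apply: is_deriveD.
by apply: DeriveDef; [exact: dF|rewrite -derive1E; exact: F'].
Qed.

(** Replaces the passage to the limit in the geometric error bounds. *)
Lemma le_geometric_le0 (A D : R) : (forall n, A <= D * 2 ^- n) -> A <= 0.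
Proof.
move=> AD; rewrite leNgt; apply/negP => A0.
have D0 : 0 < D by have := AD 0; rewrite expr0 invr1 mulr1; exact: lt_le_trans.
have [n nD] : exists n : nat, D / A < n%:R.
  by exists (Num.truncn (D / A)).+1; exact: truncnS_gt.
have := AD n; rewrite leNgt => /negP; apply.
rewrite ltr_pdivrMr ?exprn_gt0//.
move: nD; rewrite ltr_pdivrMr// => nD; apply: lt_trans nD _.
by rewrite mulrC ltr_pM2l// -natrX ltr_nat ltn_expl.
Qed.

Context {N : nat} (f : 'rV[R]_N -> 'rV[R]_N) (B L : R) (x0 : 'rV[R]_N).
Hypotheses (B0 : 0 < B) (L0 : 0 < L) (fB : forall x k, `|f x 0 k| <= B)
  (fL : forall x y k, `|f x 0 k - f y 0 k| <= L * `|x - y|).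
Implicit Types (u w x : R -> 'rV[R]_N) (s t : R).

Let start u := u 0 = x0 /\ forall s t, `|u s - u t| <= B * `|s - t|.

Let follows u w := forall t k, 0 < t -> is_derive t 1 (fun s => w s 0 k) (f (u t) 0 k).

(** The weight of a Bielecki norm; the exponent [2 L] makes the Picard map contract by one half on
    the whole half-line. *)
Let E t : R := expR (2 * L * t).

Let E_derive c t : is_derive t 1 (fun s => c * E s) (2 * L * c * E t).
Proof.
have -> : (fun s => c * E s) = c \*: (expR \o *%R (2 * L)) by [].
have D1 := is_derive1_comp (is_derive_expR (2 * L * t)) (is_derive_linear (2 * L) t).
apply: is_derive_eq (is_deriveZ c D1) _.
by rewrite /GRing.scale /= /E; ring.
Qed.

Let coord_within u s t k : start u -> {within `[s, t], continuous (fun r => u r 0 k)}.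
Proof.
move=> [_ uB]; apply: continuous_subspaceT.
apply: (@lipschitz_continuous _ _ _ _ B) => r r'; apply: le_trans (uB r r').
by have := coord_le_norm (u r - u r') k; rewrite !mxE.
Qed.

(** The condition [start u] stands under the existential so that choice yields a map defined on all
    curves. *)
Lemma picard_step u : exists w, start u -> start w /\ follows u w.
Proof.
have [su|su] := pselect (start u); last by exists u.
have cont k : continuous (fun t => f (u t) 0 k).
  apply: (@lipschitz_continuous _ _ _ _ (L * B)) => s t.
  apply: le_trans (fL _ _ _) _; rewrite -mulrA ler_pM2l//.
  exact: su.2.
have /choice[H HP] : forall k, exists H : R -> R,
    H 0 = x0 0 k /\ forall t : R, 0 <= t -> is_derive t 1 H (f (u t) 0 k).
  by move=> k; have [H H0 HD] := antiderivative (x0 0 k) (cont k); exists H.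
have HB k s t : 0 <= s -> s <= t -> `|H k s - H k t| <= B * (t - s).
  move=> s0 st; rewrite distrC mulrBr.
  have D r : s <= r -> is_derive r 1 (H k) (f (u r) 0 k).
    by move=> sr; apply: (HP k).2; exact: le_trans sr.
  apply: (@increment_norm_le _ _ (fun r => f (u r) 0 k) _ (fun=> B)) => //.
  - by move=> r /andP[sr _]; exact/D/ltW.
  - by move=> r _; exact: is_derive_linear.
  - apply: continuous_in_subspaceT => r; rewrite inE /= in_itv /= => /andP[sr _].
    exact: derive_continuous (D r sr).
  - by apply: (@derive_within_continuous _ _ (fun=> B)) => r; exact: is_derive_linear.
(* Freezing the curve at negative times makes it Lipschitz on all of [R]. *)
exists (fun t => \row_k H k (Num.max t 0)) => _; split; [split|].
- by apply/rowP => k; rewrite mxE maxxx (HP k).1.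
- move=> s t; wlog st : s t / s <= t.
    move=> W; case: (leP s t) => [|/ltW] /W //.
    by rewrite distrC (distrC s).
  apply: norm_rV_le => [|k]; first by rewrite mulr_ge0// ltW.
  rewrite !mxE; apply: le_trans (HB _ _ _ _ _) _.
  - by rewrite le_max lexx orbT.
  - by rewrite ge_max !le_max st lexx !orbT.
  - rewrite ler_pM2l// distrC ger0_norm ?subr_ge0//.
    by case: (leP s 0); case: (leP t 0) => //; lra.
- move=> t k t0.
  apply: (near_eq_is_derive (f := H k)) => //; last exact: (HP k).2 t (ltW t0).
  near=> s; rewrite mxE max_l//; apply: ltW; near: s; exact: lt_nbhsr.
Unshelve. all: by end_near. Qed.

(** The derivatives differ by at most [L * c * E], which is the derivative of [c / 2 * E]. *)
Lemma follows_contract c u u' w w' : start u -> start u' -> start w -> start w' ->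
  follows u w -> follows u' w' ->
  (forall t, 0 <= t -> `|u t - u' t| <= c * E t) ->
  forall t, 0 <= t -> `|w t - w' t| <= c / 2 * E t.
Proof.
move=> su su' sw sw' uw uw' uu' t t0.
have c0 : 0 <= c.
  have := uu' 0 (lexx _); rewrite su.1 su'.1 subrr normr0 /E mulr0 expR0 mulr1//.
apply: norm_rV_le => [|k].
  by rewrite mulr_ge0 ?divr_ge0// expR_ge0.
pose d s := w s 0 k - w' s 0 k.
have d0 : d 0 = 0 by rewrite /d sw.1 sw'.1 subrr.
rewrite !mxE -/(d t) -[d t]subr0 -d0.
apply: (@le_trans _ _ (c / 2 * E t - c / 2 * E 0)); last first.
  by rewrite lerBlDr lerDl !mulr_ge0 ?invr_ge0// expR_ge0.
apply: (@increment_norm_le _ _ (fun s => f (u s) 0 k - f (u' s) 0 k)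
  (fun s => c / 2 * E s) (fun s => 2 * L * (c / 2) * E s)) => //.
- by move=> s /andP[s0 _]; have ? := uw s k s0; have ? := uw' s k s0; exact: is_deriveB.
- by apply: within_continuousB; exact: coord_within.
- exact: derive_within_continuous (E_derive (c / 2)).
- move=> s /andP[s0 _]; apply: le_trans (fL _ _ _) _.
  have := uu' s (ltW s0); rewrite -(ler_pM2l L0); lra.
Qed.

Theorem cauchy_lipschitz_bounded : exists w, [/\ w 0 = x0,
  {within `[0, +oo[, continuous w} &
  forall t, 0 < t -> is_derive t 1 w (f (w t))].
Proof.
have [S SP] := choice picard_step.
pose u n := iter n S (cst x0).
have su n : start (u n).
  elim: n => [|n /SP[]//]; split=> // s t.
  by rewrite subrr normr0 mulr_ge0// ltW.
have fu n : follows (u n) (u n.+1) by have [] := SP _ (su n).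
(* The first step moves by at most [B t], and [2 L t <= E t]. *)
pose K : R := B / (2 * L).
have K0 : 0 < K by rewrite divr_gt0// mulr_gt0.
have Kn n t : 0 <= 2 * K * 2 ^- n * E t.
  apply: mulr_ge0; last exact: expR_ge0.
  by rewrite mulr_ge0 ?invr_ge0 ?exprn_ge0// mulr_ge0// ltW.
have uS n t : 0 <= t -> `|u n.+1 t - u n t| <= K * 2 ^- n * E t.
  elim: n t => [|n IH] t t0.
    have := (su 1%N).2 t 0; rewrite (su 1%N).1 subr0 ger0_norm// expr0 invr1 mulr1.
    move=> H; apply: le_trans H _; rewrite /K -mulrA ler_pM2l// mulrC.
    rewrite ler_pdivlMr ?mulr_gt0// mulrC; apply: le_trans (expR_ge1Dx _).
    by rewrite lerDr.
  have -> : K * 2 ^- n.+1 = K * 2 ^- n / 2 by rewrite exprS invfM mulrCA mulrC -mulrA.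
  exact: (follows_contract (su n.+1) (su n) (su n.+2) (su n.+1)).
have uC n m t : 0 <= t ->
    `|u (m + n)%N t - u n t| <= (2 * K * 2 ^- n - 2 * K * 2 ^- (m + n)) * E t.
  move=> t0; elim: m => [|m IH]; first by rewrite add0n !subrr normr0 mul0r.
  rewrite addSn exprS invfM; apply: le_trans (ler_distD (u (m + n)%N t) _ _) _.
  by have := uS (m + n)%N t t0; lra.
have u2 n m t k : 0 <= t ->
    `|u m t 0 k - u n t 0 k| <= 2 * K * 2 ^- n * E t + 2 * K * 2 ^- m * E t.
  move=> t0; have key i j : (i <= j)%N ->
      `|u j t 0 k - u i t 0 k| <= 2 * K * 2 ^- i * E t + 2 * K * 2 ^- j * E t.
    move=> ij; have := uC i (j - i)%N t t0; rewrite subnK// => H.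
    have := coord_le_norm (u j t - u i t) k; rewrite !mxE.
    by have := Kn i t; have := Kn j t; lra.
  have [nm|mn] := leqP n m; first exact: key.
  by rewrite distrC [leRHS]addrC key// ltnW.
(* The limit as a supremum of lower estimates: by [u2], each [u n] plus its error bounds all of them
   from above. *)
pose A t k := [set u n t 0 k - 2 * K * 2 ^- n * E t | n in setT].
pose x t : 'rV[R]_N := \row_k sup (A (Num.max t 0) k).
have xu n t k : 0 <= t -> `|x t 0 k - u n t 0 k| <= 2 * K * 2 ^- n * E t.
  move=> t0; rewrite mxE max_l// ler_norml; apply/andP; split.
    suff : u n t 0 k - 2 * K * 2 ^- n * E t <= sup (A t k) by lra.
    apply: ub_le_sup; last by exists n.
    exists (u n t 0 k + 2 * K * 2 ^- n * E t) => _ [m _ <-].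
    by have := u2 n m t k t0; rewrite ler_norml; lra.
  suff : sup (A t k) <= u n t 0 k + 2 * K * 2 ^- n * E t by lra.
  apply: ge_sup; first by exists (u 0%N t 0 k - 2 * K * 2 ^- 0 * E t), 0%N.
  by move=> _ [m _ <-]; have := u2 n m t k t0; rewrite ler_norml; lra.
have xu' n t : 0 <= t -> `|u n t - x t| <= 2 * K * 2 ^- n * E t.
  move=> t0; apply: norm_rV_le => [|k]; first exact: Kn.
  by have := xu n t k t0; rewrite !mxE distrC.
have sx : start x.
  split.
    apply/rowP => k; apply/eqP; rewrite -subr_eq0 -normr_le0.
    apply: (@le_geometric_le0 _ (2 * K * E 0)) => n.
    by have := xu n 0 k (lexx 0); rewrite (su n).1; lra.
  have xmax t : x t = x (Num.max t 0) by apply/rowP => k; rewrite !mxE -maxA maxxx.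
  move=> s t; wlog [s0 t0] : s t / 0 <= s /\ 0 <= t.
    move=> W; rewrite xmax [x t]xmax; apply: le_trans (W _ _ _) _.
      by rewrite !le_max lexx !orbT.
    rewrite ler_pM2l//; case: (leP s 0); case: (leP t 0) => //= h1 h2.
    - by rewrite subrr normr0.
    - by rewrite !ltr0_norm; lra.
    - by rewrite !gtr0_norm; lra.
  rewrite -subr_le0; apply: (@le_geometric_le0 _ (2 * K * (E s + E t))) => n.
  rewrite lerBlDr; apply: le_trans (ler_distD (u n s) _ _) _.
  have -> : 2 * K * (E s + E t) * 2 ^- n + B * `|s - t| =
      2 * K * 2 ^- n * E s + (B * `|s - t| + 2 * K * 2 ^- n * E t) by ring.
  apply: lerD; first by rewrite distrC xu'.
  apply: le_trans (ler_distD (u n t) _ _) _.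
  by apply: lerD; [exact: (su n).2|exact: xu'].
(* The Picard image [w] of the limit [x] is also a limit of the iterates, by contraction, so [x] is
   a fixed point on nonnegative times. *)
have [w [sw xw]] : exists w, start w /\ follows x w by exists (S x); exact: SP.
have wx t : 0 <= t -> w t = x t.
  move=> t0; apply/eqP; rewrite -subr_eq0 -normr_le0.
  apply: (@le_geometric_le0 _ (2 * K * E t)) => n.
  have H1 := follows_contract (su n) sx (su n.+1) sw (fu n) xw (xu' n) t0.
  have := xu' n.+1 t t0; rewrite exprS invfM => H2.
  by have := ler_distD (u n.+1 t) (w t) (x t); rewrite (distrC (w t) (u n.+1 t)); lra.
exists w; split; first exact: sw.1.
  apply: continuous_subspaceT; exact: lipschitz_continuous sw.2.
move=> t t0; apply: is_derive_row => k; rewrite wx; last exact: ltW.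
exact: xw.
Qed.

End cauchy_lipschitz.

(** * Instability of the other equilibria *)

Section instability.
Context {R : realType} {N : nat} {e : rel 'I_N} {a b rho : R} {g q : R -> R}.
Hypotheses (hN : (2 <= N)%N) (he : connected_graph e) (ha : 0 < a).
Hypotheses (lg : coupling_law N a b rho g) (hq : squared_distance g q).
Implicit Types (y v : 'rV[R]_N) (S : {set 'I_N}).

Let f := velocity e g.
Let V := potential e q.

Definition far_cut y S : Prop :=
  forall i j, i \in S -> j \notin S ->
  forall n : int, rho < `|y 0 i - y 0 j + 2 * pi * n%:~R|.

(* Agents are added one at a time, each close to one already lifted. *)
Lemma lift_or_cut y :
  (exists m, forall i j,
     `|torus_shift m y 0 i - torus_shift m y 0 j| <= (N%:R - 1) * rho) \/
  (exists S, [/\ exists i, i \in S, exists j, j \notin S & far_cut y S]).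
Proof.
have i0 : 'I_N := Ordinal (leq_trans (isT : (0 < 2)%N) hN).
have [C|nC] := pselect (exists S, [/\ exists i, i \in S, exists j, j \notin S & far_cut y S]).
  by right.
(* Induction on [k] up to [N - 1]: some [k + 1] agents lift with diameter at most [k rho]. *)
left; suff [A [m [cA Am]]] : exists A : {set 'I_N}, exists m, #|A| = N.-1.+1 /\
    {in A &, forall i j, `|torus_shift m y 0 i - torus_shift m y 0 j| <= N.-1%:R * rho}.
  exists m => i j; have NN : N.-1.+1 = N by apply: prednK; exact: ltnW.
  have AT : A = [set: 'I_N]%SET.
    by apply/eqP; rewrite eqEcard finset.subsetT cardsT card_ord cA NN leqnn.
  have -> : N%:R - 1 = N.-1%:R :> R by rewrite -[in LHS]NN -natr1 addrK.
  by apply: Am; rewrite AT inE.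
have : (N.-1 < N)%N by rewrite prednK// ltnW.
elim: N.-1 => [_|k IH kN].
  exists [set i0]%SET, (fun=> 0); rewrite cards1; split=> // i j.
  by rewrite !inE => /eqP-> /eqP->; rewrite subrr normr0 mul0r.
have [A [m [cA Am]]] := IH (ltnW kN).
have [[u [w [n [uA wA uw]]]]|far] := pselect (exists u w (n : int),
    [/\ u \in A, w \notin A & `|y 0 u - y 0 w + 2 * pi * n%:~R| <= rho]).
  (* With [m u - n] turns the lift of [w] falls within [rho] of that of [u]. *)
  pose m' i := if i == w then m u - n else m i.
  have mA i : i \in A -> torus_shift m' y 0 i = torus_shift m y 0 i.
    by move=> iA; rewrite !mxE /m'; case: eqP wA => // <-; rewrite iA.
  have wu i : i \in A ->
      `|torus_shift m' y 0 i - torus_shift m' y 0 w| <= k.+1%:R * rho.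
    move=> iA; rewrite mA// -natr1 mulrDl mul1r.
    apply: le_trans (ler_distD (torus_shift m y 0 u) _ _) _.
    apply: lerD; first exact: Am.
    apply: le_trans uw; rewrite !mxE /m' eqxx intrB le_eqVlt; apply/orP; left.
    by apply/eqP; congr `|_|; ring.
  exists (w |: A)%SET, m'; split; first by rewrite cardsU1 wA cA add1n.
  have rho0 := law_rho lg.
  move=> i j; rewrite !inE => /orP[/eqP->|iA] /orP[/eqP->|jA].
  - by rewrite subrr normr0 mulr_ge0.
  - by rewrite distrC wu.
  - exact: wu.
  - rewrite !mA//; apply: le_trans (Am _ _ iA jA) _.
    by rewrite ler_wpM2r// ler_nat.
(* No outside agent is close to [A], which is not everything by cardinality: [A] is a far cut. *)
case: nC; exists A; split.
- by apply/set0Pn; rewrite -card_gt0 cA.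
- apply/existsP; rewrite -negb_forall; apply: contraL kN => /forallP H.
  by rewrite -leqNgt -[N]card_ord -cA subset_leq_card//; apply/fintype.subsetP.
- move=> i j iA jA n; rewrite ltNge; apply/negP => le.
  by apply: far; exists i, j, n.
Qed.

Definition cut_direction S : 'rV[R]_N := \row_k (k \in S)%:R.

Lemma cut_direction_norm S : `|cut_direction S| <= 1.
Proof.
by apply: norm_rV_le => // k; rewrite mxE; case: (k \in S); rewrite ?normr1 ?normr0.
Qed.

(** Rotating [S] rigidly changes only the edges across the cut, where [q] is exactly quadratic. The
    first-order term vanishes at an equilibrium, leaving [- b / 4 * s ^+ 2 * D]. *)
Lemma far_cut_descent y S : f y = 0 -> far_cut y S ->
  (exists i, i \in S) -> (exists j, j \notin S) ->
  exists2 r, 0 < r & forall s, 0 < s <= r -> V (y + s *: cut_direction S) < V y.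
Proof.
move=> fy0 far [i iS] [j jS]; set v := cut_direction S.
have v01 k : v 0 k = (k \in S)%:R by rewrite mxE.
have /choice[r rP] : forall p : 'I_N * 'I_N, exists r, 0 < r /\ forall s, `|s| <= r ->
    q (y 0 p.2 - y 0 p.1 + s * (v 0 p.2 - v 0 p.1)) = q (y 0 p.2 - y 0 p.1)
      + s * (v 0 p.2 - v 0 p.1) * g (y 0 p.2 - y 0 p.1)
      - b / 2 * (s * (v 0 p.2 - v 0 p.1)) ^+ 2.
  move=> [k l] /=; rewrite !v01.
  have [kS|kS] := boolP (k \in S); have [lS|lS] := boolP (l \in S) => /=.
  - by exists 1; split=> // s _; rewrite subrr expr2 !(mulr0, mul0r) !addr0 subr0.
  - have [n|r r0 rq] := sqd_far_mod hN lg hq (t := y 0 l - y 0 k).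
      have := far k l kS lS (- n); rewrite -normrN mulrNz.
      by congr (_ < `|_|); ring.
    by exists r; split=> // s sr; rewrite sub0r mulrN1 rq// normrN.
  - have [n|r r0 rq] := sqd_far_mod hN lg hq (t := y 0 l - y 0 k).
      exact: far.
    by exists r; split=> // s sr; rewrite subr0 mulr1 rq.
  - by exists 1; split=> // s _; rewrite subrr expr2 !(mulr0, mul0r) !addr0 subr0.
(* A radius valid for all pairs at once; the default 1 only caps it. *)
exists (\big[Num.min/1]_p r p).
  by apply/bigmin_gtP; split=> // p _; exact: (rP p).1.
move=> s /andP[s0 sr].
(* [D] counts the ordered edges across the cut; if there were none, connectivity would make the
   indicator [v] constant. *)
pose D := \sum_k \sum_(j | e k j) (v 0 j - v 0 k) ^+ 2.
have D0 : 0 < D.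
  rewrite lt_neqAle; apply/andP; split; last first.
    by apply: sumr_ge0 => k _; apply: sumr_ge0 => l _; exact: sqr_ge0.
  apply/eqP => /esym DE.
  have vE : forall i j, v 0 i = v 0 j.
    apply: (connected_eqrel he) => // [k1 k2 k3 -> //|k l ekl].
    have := sum_edges_eq0 (h := fun k j => (v 0 j - v 0 k) ^+ 2) (fun _ _ => sqr_ge0 _) DE ekl.
    by move=> /eqP; rewrite sqrf_eq0 subr_eq0 => /eqP.
  by have /eqP := vE i j; rewrite !v01 iS (negPf jS) oner_eq0.
have -> : V (y + s *: v) = V y + s * (2^-1 * \sum_k \sum_(j | e k j)
    g (y 0 j - y 0 k) * (v 0 j - v 0 k)) - b / 4 * s ^+ 2 * D.
  rewrite /V /potential /D !mulr_sumr -sumrN -!big_split /=.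
  apply: eq_bigr => k _; rewrite !mulr_sumr -sumrN -!big_split /=.
  apply: eq_bigr => l _.
  have -> : (y + s *: v) 0 l - (y + s *: v) 0 k = y 0 l - y 0 k + s * (v 0 l - v 0 k).
    by rewrite !mxE; ring.
  rewrite (rP (k, l)).2 /=; first by field.
  by rewrite gtr0_norm//; apply: le_trans sr _; exact: bigmin_le.
rewrite (edge_pairing he lg) big1 => [|k _]; last by rewrite -/f fy0 !mxE mulr0.
rewrite oppr0 mulr0 addr0 gtrDl oppr_lt0.
by rewrite !mulr_gt0// ?(law_b lg)// exprn_gt0.
Qed.

Lemma equilibrium_sync_or_cut y : f y = 0 ->
  synchronized y \/
  exists S, [/\ exists i, i \in S, exists j, j \notin S & far_cut y S].
Proof.
move=> fy0; have [[m ym]|] := lift_or_cut y; last by right.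
left => i j; exists (m j - m i).
have fs : f (torus_shift m y) = 0 by rewrite /f (velocity_torus_shift lg).
have := half_circle_equilibrium hN he lg _ fs => /(_ _ i j).
rewrite !mxE intrB => H; suff : y 0 i + 2 * pi * (m i)%:~R = y 0 j + 2 * pi * (m j)%:~R by lra.
apply: H => k l; apply: le_lt_trans (law_half_circle lg).
exact: le_trans (ler_norm _) (ym k l).
Qed.

(** [V] is constant on a configuration. A solution that starts strictly below this value,
    arbitrarily close, stays below it and cannot converge to the configuration. *)
Lemma asymptotically_stable_synchronized y :
  asymptotically_stable e g y -> synchronized y.
Proof.
move=> [fy0 _ [d d0 dconv]]; have [//|[S [Si Sj far]]] := equilibrium_sync_or_cut fy0.
exfalso; have [r r0 rV] := far_cut_descent fy0 far Si Sj.
pose s := Num.min r (d / 2).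
have s0 : 0 < s by rewrite lt_min r0 divr_gt0.
have sd : s < d by rewrite gt_min; apply/orP; right; lra.
pose x0 := y + s *: cut_direction S.
have Vx0 : V x0 < V y by apply: rV; rewrite s0 ge_min lexx.
have N0 : 0 < N%:R :> R by rewrite ltr0n; exact: leq_trans hN.
have [||x1 x2 k|w [w0 cw Dw]] := @cauchy_lipschitz_bounded R N f
    (N%:R * (a * pi)) (N%:R * (a * 2)) x0 _ _ (velocity_bound ha lg).
- by rewrite !mulr_gt0// pi_gt0.
- by rewrite !mulr_gt0.
- by rewrite -!mulrA; exact: (velocity_lipschitz ha lg).
have sw : solution e g w by [].
have [c c0 cV] := potential_lipschitz (e := e) hN ha lg hq.
(* Within this distance of the configuration, [V] exceeds its initial value [V x0]. *)
have eps0 : 0 < (V y - V x0) / c by rewrite divr_gt0// subr_gt0.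
have near0 : neighborhood (configuration y) d (w 0).
  exists y; first by exists 0, (fun=> 0) => k; rewrite mulr0 !addr0.
  rewrite ball_rVE w0 /x0 opprD addNKr normrN normrZ gtr0_norm//.
  apply: le_lt_trans sd; rewrite -[leRHS]mulr1 ler_pM2l//.
  exact: cut_direction_norm.
have [T [_ HT]] := dconv w sw near0 _ eps0.
pose t := Num.max T 0 + 1.
have Tt : T < t by apply: ltr_pwDr => //; rewrite le_max lexx.
have t0 : 0 <= t by rewrite /t addr_ge0// le_max lexx orbT.
have [z [c' [m zE]]] := HT t Tt; rewrite ball_rVE ltr_pdivlMr// => zt.
have Vz : V z = V y := potential_shift hq zE.
have := potential_nonincreasing hN he ha lg hq sw (lexx 0) t0; rewrite w0.
have := cV z (w t); have := ler_norm (V z - V (w t)); rewrite -/V Vz; lra.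
Qed.

End instability.

Theorem proposition6p1 (R : realType) (N : nat) (hN : (2 <= N)%N)
    (e : rel 'I_N) (he : connected_graph e)
    (a : R) (ha : 0 < a)
    (g : R -> R) (hg : unsmoothed N a g \/ smoothed N a g)
    (zsq : R -> R) (hz : squared_distance g zsq) :
  [/\ equilibria e g = critical_points (potential e zsq),
      forall x : R -> 'rV[R]_N, solution e g x ->
        converges_to x (critical_points (potential e zsq))
    & forall theta : 'rV[R]_N,
        asymptotically_stable e g theta <-> synchronized theta].
Proof.
(* From here on both forms of the coupling are treated alike, through the common law. *)
have [rho lg] : exists rho, coupling_law N a (a / (N%:R - 1)) rho g.
  case: hg => hg; last exact: smoothed_law.
  by exists (pi / N%:R); exact: unsmoothed_law.
have E := equilibria_critical he lg hz; split=> // [x sx|theta].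
  by rewrite -E; exact: (solution_converges hN he ha lg hz sx).
split; first exact: (asymptotically_stable_synchronized hN he ha lg hz).
exact: (synchronized_asymptotically_stable hN he ha lg hz).
Qed.
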